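(* Let $n\geq 6$ and let $G=(V,E)$ be the rook's graph $K_4\square K_n$. Then there does not exist a minimum triangulation $H^*$ of $G$ with $\mathrm{tw}(H^* )=\mathrm{tw}(G)$. As a consequence, $\tau(G)>0$.
   Context: All graphs are finite, simple and undirected. The rook's graph $K_m\square K_n$ (Cartesian product of cliques) has vertex set $\{v_{r,c} : 1\le r\le m,\ 1\le c\le n\}$, with $v_{r,c}$ adjacent to $v_{r',c'}$ iff exactly one of $r=r'$, $c=c'$ holds. A triangulation of a graph $G=(V,E)$ is a chordal graph $H$ on the same vertex set $V$ with $E\subseteq E_H$; it is a minimum triangulation if $|E_H|$ is smallest among all triangulations of $G$. $\mathrm{tw}$ denotes treewidth. The parameter $\tau(G)$ is defined as $\min\{\mathrm{tw}(H) : H \text{ a minimum triangulation of } G\}-\mathrm{tw}(G)$. *)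

(* Defs.v *)
From mathcomp Require Import all_boot all_order all_algebra.
From mathcomp Require Import boolp.

Set Implicit Arguments.
Unset Strict Implicit.
Unset Printing Implicit Defensive.

Record sgraph (T : finType) := SGraph {
  adj :> rel T;
  adj_sym : symmetric adj;
  adj_irr : irreflexive adj }.

Definition edges (T : finType) (G : sgraph T) : {set {set T}} :=
  [set [set u.1; u.2] | u : T * T & G u.1 u.2].

(* In [chordal] and [is_tree] a cycle is a duplicate-free sequence c whose
   cyclically consecutive vertices are adjacent. *)
Definition chordal (T : finType) (G : sgraph T) : Prop :=
  forall c : seq T, ucycle G c -> 4 <= size c ->
    exists x y, [/\ x \in c, y \in c, G x y, y != next c x & x != next c y].

(* The bound 3 is there because [:: x; y] is a ucycle for every edge xy. *)
Definition is_tree (I : finType) (F : sgraph I) : Prop :=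
  [/\ 0 < #|I|,
      forall i j, connect F i j
    & forall c : seq I, ucycle F c -> size c < 3].

Definition connected_in (I : finType) (F : sgraph I) (S : {set I}) : Prop :=
  {in S &, forall i j, connect [rel a b | [&& a \in S, b \in S & F a b]] i j}.

Record tree_decomposition (T : finType) (G : sgraph T)
    (I : finType) (F : sgraph I) (B : I -> {set T}) : Prop := TreeDecomposition {
  td_tree : is_tree F;
  td_vertex : forall x, exists i, x \in B i;
  td_edge : forall x y, G x y -> exists i, (x \in B i) && (y \in B i);
  td_subtree : forall x, connected_in F [set i | x \in B i] }.

Definition tw_le (T : finType) (G : sgraph T) (k : nat) : Prop :=
  exists (I : finType) (F : sgraph I) (B : I -> {set T}),
    tree_decomposition G F B /\ forall i, #|B i| <= k.+1.

Definition empty_graph (T : finType) : sgraph T :=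
  @SGraph T (fun _ _ => false) (fun _ _ => erefl) (fun _ => erefl).

Lemma tw_le_card (T : finType) (G : sgraph T) : tw_le G #|T|.
Proof.
exists unit, (empty_graph unit), (fun _ => setT); split; last first.
  by move=> _; rewrite cardsT.
split.
- split=> [|[] []|[|x [|y c]] //=]; first by rewrite card_unit.
  + exact: connect0.
- by move=> x; exists tt; rewrite inE.
- by move=> x y _; exists tt; rewrite !inE.
- by move=> x [] [] _ _; apply: connect0.
Qed.

Lemma tw_exists (T : finType) (G : sgraph T) : exists k, `[< tw_le G k >].
Proof. by exists #|T|; apply/asboolP/tw_le_card. Qed.

(* The graph without vertices gets treewidth 0 instead of the usual -1. *)
Definition tw (T : finType) (G : sgraph T) : nat := ex_minn (tw_exists G).

Definition triangulation (T : finType) (G H : sgraph T) : Prop :=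
  chordal H /\ subrel G H.

Definition min_triangulation (T : finType) (G H : sgraph T) : Prop :=
  triangulation G H /\
  forall H' : sgraph T, triangulation G H' -> #|edges H| <= #|edges H'|.

Lemma neq_irr (T : finType) : irreflexive (fun x y : T => x != y).
Proof. by move=> x; rewrite eqxx. Qed.

Lemma neq_sym (T : finType) : symmetric (fun x y : T => x != y).
Proof. by move=> x y; rewrite eq_sym. Qed.

Definition complete_graph (T : finType) : sgraph T :=
  SGraph (@neq_sym T) (@neq_irr T).

Lemma complete_triangulation (T : finType) (G : sgraph T) :
  triangulation G (complete_graph T).
Proof.
split=> [[|a [|b [|d [|e c]]]] //|x y Gxy]; last first.
  by apply/negP => /eqP exy; rewrite exy adj_irr in Gxy.
move=> /andP[_ Uc] _; exists a, d.
move: Uc; rewrite /= !inE !negb_or => /and5P[/and4P[ab ad ae _]].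
move=> /and3P[bd be _] /andP[de _] _ _.
split; rewrite ?inE ?eqxx ?orbT //=.
- by rewrite eq_sym.
- by rewrite !(eq_sym d) (negPf ad) (negPf bd).
Qed.

Lemma min_triangulation_exists (T : finType) (G : sgraph T) :
  exists H, min_triangulation G H.
Proof.
pose P k := `[< exists2 H, triangulation G H & #|edges H| = k >].
have exP : exists k, P k.
  exists #|edges (complete_graph T)|; apply/asboolP.
  by exists (complete_graph T) => //; apply: complete_triangulation.
case: (ex_minnP exP) => k /asboolP[H tH eH] min_k.
exists H; split=> // H' tH'; rewrite eH; apply: min_k; apply/asboolP.
by exists H'.
Qed.

Lemma min_triangulation_tw_exists (T : finType) (G : sgraph T) :
  exists k, `[< exists H, min_triangulation G H /\ tw H = k >].
Proof.
have [H mH] := min_triangulation_exists G.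
by exists (tw H); apply/asboolP; exists H.
Qed.

Definition tau (T : finType) (G : sgraph T) : int :=
  ((ex_minn (min_triangulation_tw_exists G))%:Z - (tw G)%:Z)%R.

Definition rook_adj (m n : nat) : rel ('I_m * 'I_n) :=
  fun u v => (u.1 == v.1) (+) (u.2 == v.2).

Lemma rook_adj_sym m n : symmetric (@rook_adj m n).
Proof.
by move=> u v; rewrite /rook_adj (eq_sym u.1) (eq_sym u.2).
Qed.

Lemma rook_adj_irr m n : irreflexive (@rook_adj m n).
Proof. by move=> u; rewrite /rook_adj !eqxx. Qed.

Definition rook (m n : nat) : sgraph ('I_m * 'I_n)%type :=
  SGraph (@rook_adj_sym m n) (@rook_adj_irr m n).

(* Main.v *)
Require Import Defs.
From mathcomp Require Import all_boot all_order all_algebra.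
From mathcomp Require Import boolp zify.

(** Columns swept from left to right give tw (K_4 [] K_n) <= 2n + 1, via the
    bags {rows 0, 1} x {columns >= c} + {rows 2, 3} x {columns <= c}.

    In a chordal graph H containing the rook's graph, each 4-cycle of the rook's
    graph spanned by two rows and two columns has a diagonal in H, so |E(H)| is
    a constant plus the number of such 4-cycles with both diagonals.  Let the
    cliques of H have at most 2n + 2 vertices.  Along a perfect elimination
    ordering of H, view an eliminated cell (i, j) as a link between line i and
    line j; the remaining cells on the lines of a linked block form a clique.
    When two one-row blocks get linked, the clique bound leaves at most two
    columns in the new block, so its two rows are completely joined over n - 2
    columns.  When a block with three or four rows first appears, two rows
    of it are already joined in this way, and the clique bound or the other
    merged block yields the same for the two complementary rows.  Hence at least
    2 C(n-2, 2) 4-cycles have both diagonals.  A triangulation with a clique of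
    2n + 3 vertices needs only C(n-2, 2) + C(n-3, 2) + 2 < 2 C(n-2, 2). *)

Set Implicit Arguments.
Unset Strict Implicit.
Unset Printing Implicit Defensive.

(** * Cliques and simplicial vertices *)

Definition clique (T : finType) (G : sgraph T) (Q : {set T}) : Prop :=
  {in Q &, forall x y, x != y -> G x y}.

Definition simplicial_in (T : finType) (G : sgraph T) (U : {set T}) (v : T) :=
  {in U &, forall x y, G v x -> G v y -> x != y -> G x y}.

(** * Chordal graphs *)

Section Restriction.

Variables (T : finType) (G : sgraph T).

Lemma path_restrict (S : {set T}) x p :
  path [rel a b | [&& a \in S, b \in S & G a b]] x p ->
  path G x p /\ {subset p <= S}.
Proof.
elim: p x => //= y p IHp x /andP[/and3P[_ yS Gxy] /IHp[Gp sp]].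
by rewrite Gxy; split=> // z /predU1P[->|/sp].
Qed.

Lemma connected_in_upath (S : {set T}) x y :
  connected_in G S -> x \in S -> y \in S ->
  exists p, [/\ path G x p, uniq (x :: p), last x p = y & {subset p <= S}].
Proof.
move=> cS xS yS; have /connectP[p ep ->] := cS x y xS yS.
case/shortenP: ep => q /path_restrict[Gq sq] Uq _.
by exists q.
Qed.

Lemma connected_in1 x : connected_in G [set x].
Proof. by move=> i j /set1P-> /set1P->; apply: connect0. Qed.

Lemma connected_in_sub (A B : {set T}) x y : A \subset B ->
  connect [rel a b | [&& a \in A, b \in A & G a b]] x y ->
  connect [rel a b | [&& a \in B, b \in B & G a b]] x y.
Proof.
move=> /subsetP sAB; apply: connect_sub => a b /= /and3P[aA bA Gab].
by apply: connect1; rewrite /= !sAB.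
Qed.

Lemma connected_inU1 (A : {set T}) w a :
  connected_in G A -> a \in A -> G w a -> connected_in G (w |: A).
Proof.
move=> cA aA Gwa; pose e := [rel x y | [&& x \in w |: A, y \in w |: A & G x y]].
have wB : w \in w |: A by rewrite setU11.
have sAB : A \subset w |: A by apply: subsetUr.
have aB : a \in w |: A := subsetP sAB _ aA.
have wa : connect e w a by apply: connect1; rewrite /= wB aB.
have aw : connect e a w by apply: connect1; rewrite /= wB aB adj_sym.
move=> x y /setU1P[->|xA] /setU1P[->|yA].
- exact: connect0.
- exact: connect_trans wa (connected_in_sub sAB (cA _ _ aA yA)).
- exact: connect_trans (connected_in_sub sAB (cA _ _ xA aA)) aw.
- exact: connected_in_sub sAB (cA _ _ xA yA).
Qed.

End Restriction.

Section Chordal.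

Variables (T : finType) (G : sgraph T).
Hypothesis chG : chordal G.

(* A shortest path from w to w' would close up with d to a chordless cycle. *)
Lemma chordal_adj (A : {set T}) d w w' p :
  d \notin A -> {in A, forall a, ~~ G d a} -> G d w -> G d w' -> w != w' ->
  path G w p -> last w p = w' -> {in p, forall z, z \in w' |: A} ->
  G w w'.
Proof.
move=> dA ndA Gdw Gdw' ww'; have [m] := ubnP (size p).
elim: m p => // m IHm p; rewrite ltnS => sz Gp lastp subp.
have dw : d != w by apply: contraTneq Gdw => ->; rewrite adj_irr.
have dw' : d != w' by apply: contraTneq Gdw' => ->; rewrite adj_irr.
case/shortenP: Gp lastp => q Gq Uq sq lastq.
have szq : size q <= m.
  by apply: leq_trans sz; apply: uniq_leq_size sq; case/andP: Uq.
have {p sz subp sq}subq : {in q, forall z, z \in w' |: A}.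
  by move=> z /sq; apply: subp.
have [//|nGww'] := boolP (G w w').
have dnq z : z \in w :: q -> G d z -> (z == w) || (z == w').
  case/predU1P=> [->|/subq/setU1P[->|/ndA zA Gdz]]; rewrite ?eqxx ?orbT //.
  by rewrite Gdz in zA.
pose c := d :: w :: q.
have Uc : uniq c.
  rewrite /c cons_uniq Uq andbT inE (negPf dw) /=.
  by apply/negP=> /subq/setU1P[/eqP|]; apply/negP.
have Cc : ucycle G c.
  by apply/andP; split=> //=; rewrite Gdw rcons_path Gq lastq adj_sym.
have szc : 4 <= size c.
  rewrite /c; case: (q) Gq lastq => [|a [|b q']] //=.
    by move=> _ /eqP; rewrite (negPf ww').
  by move=> /andP[Gwa _] Ea; rewrite -Ea Gwa in nGww'.
have next_c x y s1 s3 : c = s1 ++ x :: y :: s3 -> next c x = y.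
  move=> Ec; rewrite -(next_rot (size s1) Uc) Ec rot_size_cat /=.
  by rewrite eqxx.
have next_last : next c w' = d.
  have Ec : c = belast d (w :: q) ++ [:: w'].
    by rewrite cats1 -[w'] lastq -(lastI d (w :: q)).
  rewrite -(next_rot (size (belast d (w :: q))) Uc) Ec rot_size_cat /=.
  by rewrite eqxx.
have short q' : path G w q' -> last w q' = w' -> {subset q' <= q} ->
    size q' < size q -> False.
  move=> Gq' lastq' sq' szq'; case/negP: nGww'; apply: (IHm q') => //.
    exact: leq_trans szq' szq.
  by move=> z /sq'/subq.
(* A chord of the path [w :: q] would give a shorter path, to which the induction hypothesis
   applies. *)
have no_shortcut x y s1 s2 s3 :
    w :: q = s1 ++ x :: s2 ++ y :: s3 -> G x y -> y != next c x -> False.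
  move=> Eq Gxy ny.
  have s2n : 0 < size s2.
    case: s2 Eq => // Eq; case/eqP: ny.
    by rewrite (next_c x y (d :: s1) s3) // /c Eq.
  have Sq : sorted G (w :: q) by [].
  move: Sq; rewrite Eq sorted_cat_cons cat_path /= => /and4P[Ss1 _ _ Ss3].
  have Ss : sorted G (s1 ++ x :: y :: s3).
    by rewrite sorted_cat_cons Ss1 /= Gxy.
  have lastq2 : last w' (w :: q) = w' by [].
  case: s1 Eq Ss {Ss1} => [|u s1] /= [<- Eq] Ss; rewrite Eq in short lastq2.
  - apply: (short (y :: s3)) => //.
    + by rewrite /= last_cat in lastq2.
    + by move=> z zy; rewrite mem_cat zy orbT.
    + by rewrite size_cat /= -addn1 addnC leq_add2r.
  - apply: (short (s1 ++ x :: y :: s3)) => //.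
    + by rewrite /= !last_cat /= last_cat /= in lastq2 *.
    + move=> z; rewrite !(mem_cat, in_cons).
      by case/or4P=> ->; rewrite ?orbT.
    + by rewrite !size_cat /= !size_cat /= ltn_add2l ltnS -add1n leq_add2r.
exfalso; case: (chG Cc szc) => x [y [xc yc Gxy nxy nyx]].
have Nd z : z \in w :: q -> G d z -> z != next c d -> d != next c z -> False.
  move=> zq Gdz; rewrite (next_c d w [::] q) //.
  by case/orP: (dnq z zq Gdz) => /eqP->; rewrite ?next_last eqxx.
move: xc yc; rewrite !(in_cons d).
case/predU1P=> [xd|xq] /predU1P[yd|yq].
- by rewrite xd yd adj_irr in Gxy.
- by rewrite xd in Gxy nxy nyx; case: (Nd y).
- by rewrite yd in Gxy nxy nyx; case: (Nd x) => //; rewrite adj_sym.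
have nxy' : x != y by apply: contraTneq Gxy => ->; rewrite adj_irr.
case/splitPr Eq: {1}(w :: q) / xq => [s1 s2].
move: yq; rewrite Eq mem_cat in_cons eq_sym (negPf nxy') /=.
case/orP=> [ys|ys]; case/splitPr: ys Eq => t1 t2 Eq.
- apply: (no_shortcut y x t1 t2 s2) => //; last by rewrite adj_sym.
  by rewrite Eq -catA.
- exact: (no_shortcut x y s1 t1 t2).
Qed.

(** Dirac's argument, by induction on [#|U|]. If [U] is not a clique, take a maximal connected [A]
    in [U] such that [far A] is nonempty. A simplicial vertex of [far A] stays simplicial in [U]:
    its other neighbours lie on the boundary of [A], are adjacent to all of [far A], and are
    adjacent to each other because a path through [A] links them. *)
Lemma exists_simplicial (U : {set T}) :
  U != set0 -> exists2 v, v \in U & simplicial_in G U v.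
Proof.
have [m] := ubnP #|U|; elim: m U => // m IHm U; rewrite ltnS => leUm U0.
have [cU|] := boolP [forall x in U, forall y in U, (x != y) ==> G x y].
  case/set0Pn: U0 => v vU; exists v => // x y xU yU _ _.
  by move/forall_inP: cU => /(_ x xU)/forall_inP/(_ y yU)/implyP.
case/forall_inPn=> x xU /forall_inPn[y yU]; rewrite negb_imply => /andP[xy nxy].
pose far (A : {set T}) := [set d in U | (d \notin A) && [forall a in A, ~~ G a d]].
pose P (A : {set T}) := [&& A \subset U, x \in A,
  [forall a in A, forall b in A,
     connect [rel u v | [&& u \in A, v \in A & G u v]] a b] & far A != set0].
have connP (A : {set T}) : reflect (connected_in G A) [forall a in A, forall b in A,
     connect [rel u v | [&& u \in A, v \in A & G u v]] a b].
  apply: (iffP forall_inP) => [cA a b aA bA | cA a aA].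
    by move/forall_inP: (cA a aA); apply.
  by apply/forall_inP=> b bA; apply: cA.
have Px : P [set x].
  apply/and4P; split; rewrite ?sub1set ?set11 //.
    by apply/connP; apply: connected_in1.
  apply/set0Pn; exists y; rewrite !inE yU (eq_sym y) xy /=.
  by apply/forall_inP=> a /set1P->.
have [A /maxsetP[/and4P[sAU xA /connP cA farA0] maxA] _] := maxset_exists Px.
have farP d : d \in far A -> [/\ d \in U, d \notin A & {in A, forall a, ~~ G d a}].
  rewrite inE => /and3P[dU dA /forall_inP nd]; split=> // a /nd.
  by rewrite adj_sym.
(* Otherwise [w |: A] would still leave [d] far, against the maximality of [A]. *)
have near_far w a d : w \in U -> w \notin A -> a \in A -> G w a ->
    d \in far A -> G w d.
  move=> wU wnA aA Gwa dA; have [//|nGwd] := boolP (G w d).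
  have [dU dnA nd] := farP d dA.
  have wnd : d != w by apply: contraTneq Gwa => <-; apply: nd.
  have /setP/(_ w) : w |: A = A.
    apply: maxA (subsetUr _ _); apply/and4P; split.
    - by rewrite subUset sub1set wU.
    - by rewrite inE xA orbT.
    - by apply/connP; apply: connected_inU1 Gwa.
    - apply/set0Pn; exists d; rewrite !inE dU (negPf wnd) dnA /=.
      apply/forall_inP=> b /setU1P[->//|bA].
      by rewrite adj_sym; apply: nd.
  by rewrite setU11 (negPf wnA).
have farU : far A \proper U.
  apply/properP; split; first by apply/subsetP=> d; rewrite inE => /and3P[].
  by exists x => //; rewrite inE xA andbF.
have [|//|v vA sv] := IHm (far A).
  exact: leq_trans (proper_card farU) leUm.
have [vU vnA nv] := farP v vA.
exists v => // u w uU wU Gvu Gvw uw.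
have nbrA z : G v z -> z \notin A by apply: contraTN => /nv.
have nearP z : z \in U -> G v z -> z \in far A \/ exists2 a, a \in A & G z a.
  move=> zU Gvz; have [/exists_inP[a aA Gza]|nz] := boolP [exists a in A, G z a].
    by right; exists a.
  left; rewrite inE zU nbrA //=; apply/forall_inP=> a aA; rewrite adj_sym.
  by apply: contraNN nz => Gza; apply/exists_inP; exists a.
have [[uA|[a aA Gua]] [wA|[b bA Gwb]]] := (nearP u uU Gvu, nearP w wU Gvw).
- exact: sv.
- by rewrite adj_sym; apply: near_far (nbrA w Gvw) bA Gwb uA.
- exact: near_far (nbrA u Gvu) aA Gua wA.
have [p [Gp _ lastp sp]] := connected_in_upath cA aA bA.
apply: (@chordal_adj A v u w (rcons (a :: p) w)) => //.
- by rewrite /= Gua rcons_path Gp lastp adj_sym.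
- by rewrite last_rcons.
- move=> z; rewrite mem_rcons in_cons => /predU1P[->|]; first exact: setU11.
  by case/predU1P=> [->|/sp zA]; rewrite inE ?aA ?zA orbT.
Qed.

End Chordal.

(** * Tree decompositions *)

Section Tree.

Variables (I : finType) (F : sgraph I).
Hypothesis acyclicF : forall c : seq I, ucycle F c -> size c < 3.

(** Otherwise [x] closes the path into a cycle of length at least three. *)
Lemma acyclic_branch x a b p : F x a -> F x b ->
  path F a p -> last a p = b -> x \notin p -> a = b.
Proof.
move=> Fxa Fxb; case/shortenP=> q Fq Uq sq lastq xp.
have xa : x != a by apply: contraTneq Fxa => <-; rewrite adj_irr.
have xq : x \notin q by apply: contra xp; apply: sq.
have : size (x :: a :: q) < 3.
  apply: acyclicF; rewrite /ucycle /= Fxa rcons_path Fq lastq adj_sym Fxb.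
  by rewrite inE (negPf xa) xq.
by case: (q) lastq.
Qed.

(** Where the paths part, going along one to the common end and back along the other joins two
    neighbours of the branching vertex while avoiding it. *)
Lemma upath_unique x p q : path F x p -> path F x q ->
  uniq (x :: p) -> uniq (x :: q) -> last x p = last x q -> p = q.
Proof.
elim: p x q => [|a p IHp] x [|b q] //=.
- by move=> _ _ _ /andP[xq _] xl; rewrite xl mem_last in xq.
- by move=> _ _ /andP[xp _] _ xl; rewrite -xl mem_last in xp.
move=> /andP[Fxa Fp] /andP[Fxb Fq] /andP[xap Uap] /andP[xbq Ubq] Epq.
suff ab : a = b by rewrite -ab in Fq Ubq Epq *; congr cons; apply: IHp Epq.
apply: (@acyclic_branch x a b (p ++ rev (belast b q))) => //.
- rewrite cat_path Fp Epq rev_path.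
  by apply: sub_path Fq => u v; rewrite /= adj_sym.
- by case: (q) Epq => [|c q'] Epq; rewrite last_cat //= rev_cons last_rcons.
rewrite mem_cat negb_or mem_rev; move: xap xbq; rewrite in_cons negb_or.
move=> /andP[_ ->] xbq; apply: contra xbq; exact: mem_belast.
Qed.

Lemma first_hit (a : pred I) x p : path F x p -> uniq (x :: p) ->
  ~~ a x -> a (last x p) -> exists q k, [/\ path F x (rcons q k),
    uniq (x :: rcons q k), a k, ~~ has a (x :: q) & {subset rcons q k <= p}].
Proof.
elim: p x => [|y p IHp] x /=; first by move=> _ _ /negPf->.
move=> /andP[Fxy Fp] /andP[xyp Uyp] nax al.
have [ay|nay] := boolP (a y).
  exists [::], y; split; rewrite /= ?Fxy ?(negPf nax) //.
    by move: xyp; rewrite !in_cons !negb_or => /andP[->].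
  by move=> z; rewrite inE => /eqP->; apply: mem_head.
have [q [k [Fq Uq ak naq sq]]] := IHp y Fp Uyp nay al.
have syq : {subset y :: rcons q k <= y :: p}.
  by move=> z /predU1P[->|/sq zp]; rewrite in_cons ?eqxx ?zp ?orbT.
exists (y :: q), k; split=> //=; first by rewrite Fxy.
  rewrite -/(uniq (y :: rcons q k)) Uq andbT.
  by apply: contra xyp; apply: syq.
by rewrite negb_or nax.
Qed.

End Tree.

(** Helly property of subtrees. Take a bag [B i] meeting [Q] in the most vertices. If it misses [x]
    in [Q], the first bag containing [x] on a path from [i] holds [x] and all of [B i :&: Q], a
    contradiction. *)
Lemma clique_sub_bag (T : finType) (G : sgraph T) (I : finType) (F : sgraph I)
    (B : I -> {set T}) (Q : {set T}) :
  tree_decomposition G F B -> clique G Q -> exists i, Q \subset B i.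
Proof.
case=> [[I0 connF acF] tdV tdE tdS] cQ.
have /card_gt0P[i0 _] := I0.
case: (@arg_maxnP I i0 predT (fun i => #|B i :&: Q|) isT) => i _ maxi.
exists i; apply/subsetP=> x xQ; have [//|xnBi] := boolP (x \in B i).
have [j xBj] := tdV x.
have [p [Fp Up lastp _]] : exists p, [/\ path F i p, uniq (i :: p),
    last i p = j & {subset p <= predT}].
  have /connectP[p Fp ->] := connF i j.
  by case/shortenP: Fp => q Fq Uq _; exists q.
have [||q [k [Fq Uq xBk nq _]]] := @first_hit _ F (fun i => x \in B i) i p Fp Up.
- by [].
- by rewrite lastp.
suff sBQ : x |: (B i :&: Q) \subset B k :&: Q.
  have := leq_trans (subset_leq_card sBQ) (maxi k isT).
  by rewrite cardsU1 inE (negPf xnBi) ltnn.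
rewrite subUset sub1set inE xBk xQ /=; apply/subsetP=> y; rewrite !inE.
move=> /andP[yBi yQ]; rewrite yQ andbT.
have yx : y != x by apply: contraNneq xnBi => <-.
have [l /andP[yBl xBl]] := tdE y x (cQ y x yQ xQ yx).
(* Inside the subtree of [y] a path leads from [i] to a bag with [x]. Since paths are unique, it
   enters the subtree of [x] at [k], so [y] is in [B k]. *)
have [||r [Fr Ur lastr sr]] := connected_in_upath (tdS y) (x := i) (y := l).
- by rewrite inE.
- by rewrite inE.
have [||r1 [k1 [Fr1 Ur1 xBk1 nr1 sr1]]] :=
    @first_hit _ F (fun i => x \in B i) i r Fr Ur.
- by [].
- by rewrite lastr.
have [||s [Fs Us lasts ss]] := connected_in_upath (tdS x) (x := k) (y := k1).
- by rewrite inE.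
- by rewrite inE.
have Eq : rcons q k ++ s = rcons r1 k1.
  apply: (upath_unique acF (x := i)) => //.
  - by rewrite cat_path last_rcons Fq Fs.
  - rewrite -cat_cons cat_uniq Uq; move: Us; rewrite cons_uniq => /andP[ks ->].
    rewrite andbT /=.
    apply/hasPn=> z zs; rewrite -rcons_cons mem_rcons in_cons negb_or.
    apply/andP; split; first by apply: contraNneq ks => <-.
    apply: contraNN nq => ziq; apply/hasP; exists z => //.
    by have := ss z zs; rewrite inE.
  - by rewrite last_cat !last_rcons.
have : k \in r by apply: sr1; rewrite -Eq mem_cat mem_rcons mem_head.
by move/sr; rewrite inE.
Qed.

Lemma clique_tw_le (T : finType) (G : sgraph T) (Q : {set T}) k :
  tw_le G k -> clique G Q -> #|Q| <= k.+1.
Proof.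
case=> I [F [B [tdB szB]]] cQ; have [i sQB] := clique_sub_bag tdB cQ.
exact: leq_trans (subset_leq_card sQB) (szB i).
Qed.

Lemma tw_le_tw (T : finType) (G : sgraph T) : tw_le G (tw G).
Proof. by rewrite /tw; case: ex_minnP => k /asboolP. Qed.

Lemma tw_leP (T : finType) (G : sgraph T) k : tw_le G k -> tw G <= k.
Proof. by move=> Gk; rewrite /tw; case: ex_minnP => m _; apply; apply/asboolP. Qed.

Lemma tw_subrel (T : finType) (G H : sgraph T) : subrel G H -> tw G <= tw H.
Proof.
move=> sGH; apply: tw_leP; have [I [F [B [[tree V E S] szB]]]] := tw_le_tw H.
by exists I, F, B; split=> //; split=> // x y /sGH/E.
Qed.

(** * A path decomposition of the rook's graph *)

Definition path_adj n : rel 'I_n := fun i j => (i.+1 == j) || (j.+1 == i).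

Lemma path_adj_sym n : symmetric (@path_adj n).
Proof. by move=> i j; rewrite /path_adj orbC. Qed.

Lemma path_adj_irr n : irreflexive (@path_adj n).
Proof. by move=> i; rewrite /path_adj; lia. Qed.

Definition path_graph n : sgraph 'I_n :=
  SGraph (@path_adj_sym n) (@path_adj_irr n).

Lemma path_graph_connected n (S : {set 'I_n}) :
  (forall i j k : 'I_n, i \in S -> k \in S -> i <= j <= k -> j \in S) ->
  connected_in (path_graph n) S.
Proof.
move=> ivS; pose e := [rel a b | [&& a \in S, b \in S & path_graph n a b]].
have up d (i k : 'I_n) : i \in S -> k \in S -> k = i + d :> nat -> connect e i k.
  elim: d k => [|d IHd] k iS kS Ek.
    by rewrite (_ : k = i) ?connect0 //; apply: val_inj; rewrite /= Ek addn0.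
  have ltjn : i + d < n by have := ltn_ord k; lia.
  pose j : 'I_n := Ordinal ltjn.
  have jS : j \in S by apply: (ivS i j k) => //=; lia.
  apply: connect_trans (IHd j iS jS erefl) (connect1 _).
  by rewrite /= jS kS /path_adj /= Ek addnS eqxx.
have eS : connect_sym e.
  apply: sym_connect_sym => a b; rewrite /= path_adj_sym.
  by case: (a \in S); rewrite /= ?andbF.
move=> i k iS kS; have [ik|ki] := leqP i k.
  by apply: (up (k - i)) => //; lia.
by rewrite -/e eS; apply: (up (i - k)) => //; lia.
Qed.

(** On a cycle, both neighbours of the least vertex would be its successor. *)
Lemma path_graph_tree n : is_tree (path_graph n.+1).
Proof.
split; first by rewrite card_ord.
  move=> i j; have := @path_graph_connected n.+1 setT (fun _ _ _ _ _ _ => in_setT _).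
  move=> /(_ i j (in_setT _) (in_setT _)); apply: connect_sub => a b /= /and3P[_ _ ab].
  exact: connect1.
move=> c cc; have [//|szc] := ltnP (size c) 3.
have [x0 x0c] : exists x, x \in c by case: c szc {cc} => // x c; exists x; apply: mem_head.
case: (@arg_minnP _ x0 (mem c) (fun i => i : nat) x0c) => x xc minx.
have [k c' Ec] := rot_to xc.
have : ucycle (path_graph n.+1) (x :: c').
  by move: cc; rewrite /ucycle -(rot_cycle k) -(rot_uniq k) Ec.
have {szc} : 3 <= size (x :: c') by rewrite -Ec size_rot.
have {}minx : {in x :: c', forall i : 'I_n.+1, x <= i}.
  by move=> i; rewrite -Ec mem_rot; apply: minx.
case/lastP: c' minx {Ec} => [|[|y c'] z] //= minx _.
rewrite /ucycle /= !rcons_path !last_rcons /= => /andP[/and3P[xy _ zx]].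
have [ly lz] : x <= y /\ x <= z.
  by split; apply: minx; rewrite !(in_cons, mem_rcons) eqxx ?orbT.
have -> : y = z by apply: val_inj; move: xy zx; rewrite /path_adj /=; lia.
by rewrite mem_rcons mem_head andbF.
Qed.

Lemma card_ord_lt n m : m <= n -> #|[set j : 'I_n | j < m]| = m.
Proof.
move=> lemn.
have inj : injective (widen_ord lemn).
  by move=> i j /(congr1 val) /= /val_inj.
rewrite -[RHS]card_ord -(card_imset _ inj).
apply: eq_card => j; rewrite inE; apply/idP/imsetP => [ltjm | [i _ ->]] /=.
  by exists (Ordinal ltjm) => //; apply: val_inj.
exact: ltn_ord.
Qed.

Lemma card_ord_ge n m : m <= n -> #|[set j : 'I_n | m <= j]| = n - m.
Proof.
move=> lemn; have := cardsC [set j : 'I_n | j < m].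
rewrite card_ord_lt // card_ord => Ec.
have <- : #|~: [set j : 'I_n | j < m]| = n - m by apply: (canRL (addKn m)).
by apply: eq_card => j; rewrite !inE -leqNgt.
Qed.

Definition row_split_bag n (c : 'I_n) : {set 'I_4 * 'I_n} :=
  [set u : 'I_4 * 'I_n | if u.1 < 2 then c <= u.2 else u.2 <= c].

(** Two rows give [n - c] cells each, the other two [c + 1] each. *)
Lemma card_row_split_bag n (c : 'I_n) : #|row_split_bag c| = (n.+1).*2.
Proof.
have ltcn := ltn_ord c.
pose R := [set p : 'I_4 | p < 2].
have -> : row_split_bag c = setX R [set j : 'I_n | c <= j]
                        :|: setX (~: R) [set j : 'I_n | j < c.+1].
  by apply/setP=> -[p j]; rewrite !inE /=; case: (p < 2); rewrite ?orbF.
rewrite cardsU disjoint_setI0 ?cards0; last first.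
  rewrite -setI_eq0; apply/eqP/setP=> -[p j]; rewrite !inE /=.
  by case: (p < 2); rewrite ?andbF.
rewrite !cardsX [#|~: R|]cardsCs setCK !card_ord_lt ?card_ord_ge ?card_ord //; last exact: ltnW.
by lia.
Qed.

Lemma rook_tw_le n : 0 < n -> tw (rook 4 n) <= (n.*2).+1.
Proof.
case: n => // n _; apply: tw_leP.
exists 'I_n.+1, (path_graph n.+1), (@row_split_bag n.+1); split; last first.
  by move=> i; rewrite card_row_split_bag; lia.
split; first exact: path_graph_tree.
- by move=> x; exists x.2; rewrite inE leqnn if_same.
- move=> [p j] [q l]; rewrite /= /rook_adj /= => Gxy.
  have [<-|npq] := eqVneq p q.
    (* The first bag holds rows 0 and 1 in full, the last bag rows 2 and 3. *)
    exists (if p < 2 then ord0 else ord_max); rewrite !inE /=.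
    by case: (p < 2); rewrite /= ?leq_ord.
  have ->: l = j by move: Gxy; rewrite (negPf npq) => /eqP.
  by exists j; rewrite !inE /= leqnn !if_same.
- move=> [p j]; apply: path_graph_connected => i k l; rewrite !inE /=.
  by case: (p < 2); lia.
Qed.

(** * Elimination of the cells of the rook's graph *)

(* The rows in A form a clique together with all but at most two columns. *)
Definition joined n (H : sgraph ('I_4 * 'I_n)%type) (A : {set 'I_4}) : Prop :=
  exists2 K : {set 'I_n}, n <= #|K| + 2 & clique H (setX A K).

Section Elimination.

Variables (n : nat) (H : sgraph ('I_4 * 'I_n)%type) (L : eqType).
Implicit Types (U : {set 'I_4 * 'I_n}) (fr : 'I_4 -> L) (fc : 'I_n -> L) (x y : L).

Definition rows_of fr x := [set p | fr p == x].
Definition cols_of fc x := [set j | fc j == x].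

Definition incident fr fc x : {set 'I_4 * 'I_n} :=
  [set u : 'I_4 * 'I_n | (fr u.1 == x) || (fc u.2 == x)].

(* U is the set of remaining cells; fr and fc map each row and each column to the
   label of its block. *)
Record blocks U fr fc : Prop := Blocks {
  blocks_out : forall u, u \notin U -> fr u.1 = fc u.2;
  blocks_clique : forall x, clique H (U :&: incident fr fc x);
  blocks_small : forall x, #|rows_of fr x| <= 2;
  blocks_joined : forall x, #|rows_of fr x| = 2 -> joined H (rows_of fr x) }.

Definition merge (T : Type) (f : T -> L) x y (t : T) : L :=
  if f t == y then x else f t.

Lemma merge_eq (T : Type) (f : T -> L) x y t z :
  (merge f x y t == z) =
  if z == x then (f t == x) || (f t == y) else (z != y) && (f t == z).
Proof.
rewrite /merge; case: (eqVneq (f t) y) => [->|fy].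
  case: (eqVneq z x) => [_|zx]; first by rewrite orbT.
  by rewrite (eq_sym y) andNb.
case: (eqVneq z x) => [->|zx]; first by rewrite orbF.
by case: (eqVneq z y) => [->|//]; rewrite (negPf fy).
Qed.

(** The cell [v] is on a row of block [x] and a column of block [y], so it is adjacent to all other
    remaining cells of both blocks; being simplicial, it makes them a clique. *)
Lemma merged_clique U fr fc v x y : blocks U fr fc -> v \in U ->
  simplicial_in H U v -> fr v.1 = x -> fc v.2 = y ->
  clique H (U :&: (incident fr fc x :|: incident fr fc y)).
Proof.
move=> bU vU sv frv fcv.
have nbr u : u \in U :&: (incident fr fc x :|: incident fr fc y) ->
    u \in U /\ (u != v -> H v u).
  rewrite !in_setI in_setU => /andP[uU uxy]; split=> // uv.
  case/orP: uxy => [ux|uy].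
    apply: (blocks_clique bU (x := x)); rewrite ?in_setI ?vU ?uU ?ux //.
      by rewrite inE frv eqxx.
    by rewrite eq_sym.
  apply: (blocks_clique bU (x := y)); rewrite ?in_setI ?vU ?uU ?uy //.
    by rewrite inE fcv eqxx orbT.
  by rewrite eq_sym.
move=> u w /nbr[uU Hvu] /nbr[wU Hvw] uw.
have [uv|uv] := eqVneq u v.
  by rewrite uv in uw *; apply: Hvw; rewrite eq_sym.
have [wv|wv] := eqVneq w v.
  by rewrite wv adj_sym; apply: Hvu.
by apply: sv => //; [apply: Hvu | apply: Hvw].
Qed.

Lemma card_preim_setU (T : finType) (f : T -> L) x y : x != y ->
  #|[set t | f t == x] :|: [set t | f t == y]|
    = #|[set t | f t == x]| + #|[set t | f t == y]|.
Proof.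
move=> xy; rewrite cardsU disjoint_setI0 ?cards0 ?subn0 // -setI_eq0.
apply/eqP/setP=> t; rewrite !inE; apply/negP=> /andP[/eqP->].
by apply/negP.
Qed.

(** The right-hand side bounds a cover of the grid. An eliminated cell has its row and column in one
    block, so a cell off the merged clique lies in the rectangle of [x], in that of [y], or on no
    line of either block. *)
Lemma card_merged U fr fc x y : blocks U fr fc -> x != y ->
  n * 4 <= #|U :&: (incident fr fc x :|: incident fr fc y)|
    + #|rows_of fr x| * #|cols_of fc x| + #|rows_of fr y| * #|cols_of fc y|
    + (4 - (#|rows_of fr x| + #|rows_of fr y|))
      * (n - (#|cols_of fc x| + #|cols_of fc y|)).
Proof.
move=> bU xy.
set Q := U :&: _; set Rx := rows_of fr x; set Ry := rows_of fr y.
set Cx := cols_of fc x; set Cy := cols_of fc y.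
have dR : #|Rx :|: Ry| = #|Rx| + #|Ry| := card_preim_setU fr xy.
have dC : #|Cx :|: Cy| = #|Cx| + #|Cy| := card_preim_setU fc xy.
pose W := Q :|: setX Rx Cx :|: setX Ry Cy :|: setX (~: (Rx :|: Ry)) (~: (Cx :|: Cy)).
have WT : [set: 'I_4 * 'I_n] \subset W.
  apply/subsetP=> -[p j] _; rewrite !inE /=.
  have [//|pjU] := boolP ((p, j) \in U); last first.
    have /= -> := blocks_out bU pjU.
    by case: (fc j == x); case: (fc j == y).
  by case: (fr p == x); case: (fr p == y); case: (fc j == x); case: (fc j == y).
have := subset_leq_card WT; rewrite cardsT card_prod !card_ord mulnC => leW.
have leU (A B : {set 'I_4 * 'I_n}) : #|A :|: B| <= #|A| + #|B|.
  by rewrite cardsU leq_subr.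
have cR : #|~: (Rx :|: Ry)| = 4 - (#|Rx| + #|Ry|).
  by rewrite cardsCs setCK dR card_ord.
have cC : #|~: (Cx :|: Cy)| = n - (#|Cx| + #|Cy|).
  by rewrite cardsCs setCK dC card_ord.
apply: leq_trans leW _; rewrite -cR -cC -!cardsX.
by do 3![apply: leq_trans (leU _ _) _; rewrite leq_add2r].
Qed.

(** The row and column of [v] now share a label, so [v] may be deleted. If [y] differs from [x], its
    block becomes empty; all further blocks are unchanged. *)
Lemma merge_blocks U fr fc v x y : blocks U fr fc -> fr v.1 = x -> fc v.2 = y ->
  clique H (U :&: (incident fr fc x :|: incident fr fc y)) ->
  #|rows_of fr x :|: rows_of fr y| <= 2 ->
  (#|rows_of fr x :|: rows_of fr y| = 2 ->
    joined H (rows_of fr x :|: rows_of fr y)) ->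
  blocks (U :\ v) (merge fr x y) (merge fc x y).
Proof.
move=> bU frv fcv cQ le2 j2.
have rowsE z : rows_of (merge fr x y) z = if z == x
    then rows_of fr x :|: rows_of fr y else if z == y then set0 else rows_of fr z.
  apply/setP=> p; rewrite inE merge_eq.
  by case: eqP => _; [rewrite !inE | case: eqP => _; rewrite !inE].
split=> [u|z|z|z].
- rewrite !inE negb_and negbK => /predU1P[->|/(blocks_out bU) Eu].
    by rewrite /merge frv fcv eqxx; case: ifP.
  by rewrite /merge Eu.
- suff sub : exists2 Q, clique H Q &
      (U :\ v) :&: incident (merge fr x y) (merge fc x y) z \subset Q.
    by have [Q cQ' /subsetP sQ] := sub; move=> a b /sQ aQ /sQ bQ; apply: cQ'.
  have [zx|zx] := eqVneq z x.
    exists (U :&: (incident fr fc x :|: incident fr fc y)) => //.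
    apply/subsetP=> u; rewrite !inE !merge_eq zx eqxx => /andP[/andP[_ ->]].
    by case/orP=> /orP[] ->; rewrite ?orbT.
  exists (U :&: incident fr fc z); first exact: (@blocks_clique _ _ _ bU z).
  apply/subsetP=> u; rewrite !inE !merge_eq (negPf zx) => /andP[/andP[_ ->]].
  by case/orP=> /andP[_ ->]; rewrite ?orbT.
- rewrite rowsE; case: ifP => // _; case: ifP => _; first by rewrite cards0.
  exact: blocks_small bU z.
- rewrite rowsE; case: ifP => // _; case: ifP => _; first by rewrite cards0.
  exact: blocks_joined bU z.
Qed.

(* v = (i, j) links the block of row i to the block of column j. *)
Lemma blocks_step U fr fc v : 3 <= n ->
  (forall Q : {set 'I_4 * 'I_n}, clique H Q -> #|Q| <= (n.+1).*2) ->
  blocks U fr fc -> v \in U -> simplicial_in H U v ->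
  (exists2 A : {set 'I_4}, #|A| = 2 & joined H A /\ joined H (~: A)) \/
  exists fr' fc', blocks (U :\ v) fr' fc'.
Proof.
move=> n3 leQ bU vU sv; set x := fr v.1; set y := fc v.2.
have cQ := merged_clique bU vU sv (erefl x) (erefl y).
(* A link inside one block changes no label. *)
have [xy|xy] := eqVneq x y.
  right; exists fr, fc; split; [|move=> z|exact: blocks_small bU|exact: blocks_joined bU].
    by move=> u; rewrite !inE negb_and negbK => /predU1P[->//|]; apply: blocks_out bU _.
  move=> u w; rewrite setIDAC => /setDP[uI _] /setDP[wI _].
  exact: blocks_clique uI wI.
have := card_merged bU xy; have := leQ _ cQ.
have lec : #|cols_of fc x| + #|cols_of fc y| <= n.
  by rewrite -(card_preim_setU fc xy) -[leqRHS]card_ord max_card.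
have mergeR := merge_blocks bU (erefl x) (erefl y) cQ.
have ErU : #|rows_of fr x :|: rows_of fr y| = #|rows_of fr x| + #|rows_of fr y|
  := card_preim_setU fr xy.
(* A cell on a column of block [z] but on none of its rows has two different labels, so it is not
   eliminated yet. *)
have joinedC z : n <= #|cols_of fc z| + 2 -> joined H (~: rows_of fr z).
  move=> nK; exists (cols_of fc z) => //.
  have sub u : u \in setX (~: rows_of fr z) (cols_of fc z) ->
      u \in U :&: incident fr fc z.
    rewrite !inE => /andP[nuz uz]; rewrite uz orbT andbT.
    by apply: contraNT nuz => /(blocks_out bU) ->.
  move=> u w /sub uI /sub wI; exact: blocks_clique uI wI.
set q := #|_ :&: _|; move: q => q.
have := blocks_small bU x; have := blocks_small bU y.
have : 0 < #|rows_of fr x| by apply/card_gt0P; exists v.1; rewrite inE.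
case Ex: #|rows_of fr x| => [|[|[|rx]]] // _;
  case Ey: #|rows_of fr y| => [|[|[|ry]]] // _ _ leq_q card_le;
  rewrite Ex Ey in ErU mergeR.
- right; do 2!eexists; apply: mergeR; rewrite ErU //.
(* Two one-row blocks: [4 * n <= (2 * n + 2) + cx + cy + 2 * (n - (cx + cy))] forces [cx + cy <= 2],
   and the other columns join the two rows. *)
- right; do 2!eexists; apply: mergeR; rewrite ErU // => _.
  exists (~: (cols_of fc x :|: cols_of fc y)).
    rewrite cardsCs setCK (card_preim_setU fc xy) card_ord.
    move: leq_q card_le lec.
    move: #|cols_of fc x| #|cols_of fc y| => cx cy; clear; lia.
  have sub u : u \in setX (rows_of fr x :|: rows_of fr y)
      (~: (cols_of fc x :|: cols_of fc y)) ->
      u \in U :&: (incident fr fc x :|: incident fr fc y).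
    rewrite !inE negb_or => /andP[Ru /andP[nux nuy]]; apply/andP; split.
      apply: contraTT Ru => /(blocks_out bU) ->.
      by rewrite (negPf nux) (negPf nuy).
    by case/orP: Ru => ->; rewrite ?orbT.
  by move=> u w /sub uI /sub wI; apply: cQ.
(* One row meets two: [4 * n <= (2 * n + 2) + cx + 2 * cy + (n - (cx + cy))] forces
   [n <= cy + 2]. *)
- left; exists (rows_of fr y) => //; split; first exact: (blocks_joined bU).
  apply: joinedC; move: leq_q card_le lec.
  move: #|cols_of fc x| #|cols_of fc y| => cx cy; clear; lia.
- right; do 2!eexists; apply: mergeR; rewrite ErU // => _.
  by rewrite (cards0_eq Ey) setU0; apply: (blocks_joined bU Ex).
- left; exists (rows_of fr x) => //; split; first exact: (blocks_joined bU).
  apply: joinedC; move: leq_q card_le lec.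
  move: #|cols_of fc x| #|cols_of fc y| => cx cy; clear; lia.
(* Two two-row blocks are complementary, and both are already joined. *)
- left; exists (rows_of fr x) => //; split; first exact: (blocks_joined bU).
  have -> : ~: rows_of fr x = rows_of fr y.
    apply/esym/eqP; rewrite eqEcard [#|~: _|]cardsCs setCK card_ord Ex Ey andbT.
    by apply/subsetP=> p; rewrite !inE => /eqP->; rewrite eq_sym.
  exact: (blocks_joined bU).
Qed.

End Elimination.

(** Initially every line is its own block. Were the elimination to run to the end without producing
    the pairs, all four rows would share the label of a column, against [blocks_small]. *)
Lemma two_joined_pairs n (H : sgraph ('I_4 * 'I_n)%type) : 3 <= n ->
  chordal H -> subrel (rook 4 n) H ->
  (forall Q : {set 'I_4 * 'I_n}, clique H Q -> #|Q| <= (n.+1).*2) ->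
  exists2 A : {set 'I_4}, #|A| = 2 & joined H A /\ joined H (~: A).
Proof.
move=> n3 chH sGH leQ; pose L : eqType := ('I_4 + 'I_n)%type.
suff step m (U : {set 'I_4 * 'I_n}) (fr : 'I_4 -> L) (fc : 'I_n -> L) :
    #|U| <= m -> blocks H U fr fc ->
    exists2 A : {set 'I_4}, #|A| = 2 & joined H A /\ joined H (~: A).
  have le1 z : #|rows_of (inl : 'I_4 -> L) z| <= 1.
    by apply/card_le1_eqP=> p q; rewrite !inE => /eqP <- /eqP[].
  apply: (step #|[set: 'I_4 * 'I_n]| setT inl inr) => //; split.
  - by move=> u; rewrite in_setT.
  - move=> z u w; rewrite !inE /= => uz wz uw; apply: sGH.
    rewrite /= /rook_adj; case: z uz wz => z; rewrite ?orbF /=.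
      move=> /eqP[uz] /eqP[wz]; rewrite uz wz eqxx /=.
      apply: contraNN uw => /eqP E2; case: u w uz wz E2 => [p j] [q l] /= -> ->.
      by move=> ->.
    move=> /eqP[uz] /eqP[wz]; rewrite uz wz eqxx addbT.
    apply: contraNN uw => /eqP E1; case: u w uz wz E1 => [p j] [q l] /= -> ->.
    by move=> ->.
  - by move=> z; apply: leq_trans (le1 z) _.
  - by move=> z Ez; have := le1 z; rewrite Ez.
elim: m U fr fc => [|m IHm] U fr fc leU bU.
  have U0 : U = set0 by apply/eqP; rewrite -cards_eq0 -leqn0.
  pose c0 : 'I_n := Ordinal (ltn_trans (isT : 0 < 2) n3).
  have := blocks_small bU (fc c0).
  have -> : rows_of fr (fc c0) = setT.
    apply/setP=> p; rewrite !inE.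
    by have /= -> := blocks_out bU (u := (p, c0)); rewrite ?U0 ?inE ?eqxx.
  by rewrite cardsT card_ord.
have [U0|U0] := eqVneq U set0.
  by apply: (IHm U fr fc) => //; rewrite U0 cards0.
have [v vU sv] := exists_simplicial chH U0.
have [//|[fr' [fc' bU']]] := blocks_step n3 leQ bU vU sv.
by apply: IHm bU'; move: leU; rewrite (cardsD1 v) vU.
Qed.

(** * Counting edges *)

Section Counting.

Variables (T : finType) (G : sgraph T).

(** Each edge comes from exactly two ordered pairs. *)
Lemma card_edges : (#|edges G|).*2 = #|[set u : T * T | G u.1 u.2]|.
Proof.
pose arcs := [set u : T * T | G u.1 u.2].
pose f (u : T * T) := [set u.1; u.2].
have -> : edges G = f @: arcs by apply: eq_imset => u; rewrite ?inE.
rewrite -[RHS]sum1_card (partition_big_imset f) /= -muln2 -sum_nat_const.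
apply: eq_bigr => e /imsetP[[x y]]; rewrite inE /= => Gxy ->.
have xy : x != y by apply: contraTneq Gxy => ->; rewrite adj_irr.
have -> : 2 = #|[set (x, y); (y, x)]|.
  by rewrite cards2 xpair_eqE (negPf xy).
rewrite -sum1_card; apply: eq_bigl => -[a b].
rewrite !inE /= !xpair_eqE /f /=; apply/idP/idP.
  by case/orP=> /andP[/eqP-> /eqP->]; rewrite ?Gxy ?eqxx // adj_sym Gxy setUC eqxx.
move=> /andP[Gab /eqP/setP Eab].
have ab : a != b by apply: contraTneq Gab => ->; rewrite adj_irr.
have := Eab a; have := Eab b; rewrite !inE !eqxx orbT /=.
move=> /esym/orP[] /eqP Eb /esym/orP[] /eqP Ea; rewrite Ea Eb ?eqxx ?orbT //.
  by rewrite Ea Eb eqxx in ab.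
by rewrite Ea Eb eqxx in ab.
Qed.

End Counting.

Lemma chordal_square (T : finType) (G : sgraph T) a b c d : chordal G ->
  uniq [:: a; b; c; d] -> G a b -> G b c -> G c d -> G d a -> G a c || G b d.
Proof.
move=> chG U Gab Gbc Gcd Gda.
have C : ucycle G [:: a; b; c; d] by rewrite /ucycle /= Gab Gbc Gcd Gda.
have [x [y [xc yc Gxy nx ny]]] := chG _ C isT.
have G2 u v : G u v -> G v u by rewrite adj_sym.
move: U nx ny xc yc Gxy; rewrite /= !inE !negb_or andbT.
move=> /and3P[/and3P[ab ac ad] /andP[bc bd] cd].
have ne := (eqxx, negPf ab, negPf ac, negPf ad, negPf bc, negPf bd, negPf cd).
have := ne; rewrite (eq_sym a b) (eq_sym a c) (eq_sym a d) (eq_sym b c).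
rewrite (eq_sym b d) (eq_sym c d) => ne'.
move=> nx ny /or4P[] /eqP Ex /or4P[] /eqP Ey; rewrite Ex Ey in nx ny *;
  rewrite ?adj_irr //= => Gxy; rewrite ?(ne, ne') /= ?(ne, ne') /= in nx ny;
  rewrite ?Gxy ?orbT ?(G2 _ _ Gxy) ?orbT //.
Qed.

(** * Rectangles with both diagonals *)

Section Rook.

Variable n : nat.
Notation cell := ('I_4 * 'I_n)%type.

Definition crosses (w : cell * cell) :=
  (w.1.1 != w.2.1) && (w.1.2 != w.2.2).

Definition swap_cols (w : cell * cell) : cell * cell :=
  ((w.1.1, w.2.2), (w.2.1, w.1.2)).

(** A rectangle with both diagonals is counted four times: two diagonals, each in two directions. *)
Definition crossed (H : sgraph cell) : {set cell * cell} :=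
  [set w : cell * cell | [&& crosses w, H w.1 w.2 &
     H (swap_cols w).1 (swap_cols w).2]].

(** Adjacency is summed over each ordered pair and its swap. On a common line the rook's graph
    decides the contribution; for opposite corners chordality supplies one diagonal, and a second
    one adds to [crossed]. *)
Lemma card_edges_rook (H : sgraph cell) : chordal H -> subrel (rook 4 n) H ->
  #|edges H| * 4 =
    \sum_(w : cell * cell) (if crosses w then 1 else (w.1 != w.2).*2)
    + #|crossed H|.
Proof.
move=> chH sGH.
have -> : #|edges H| * 4 = (#|edges H|.*2).*2 by lia.
rewrite card_edges -addnn.
have E1 : #|[set u : cell * cell | H u.1 u.2]| = \sum_(w : cell * cell) H w.1 w.2.
  by rewrite -sum1dep_card big_mkcond; apply: eq_bigr => w _; case: (H _ _).
have swapK : involutive swap_cols by move=> [[p j] [q l]].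
rewrite {2}E1 (reindex_inj (inv_inj swapK)) E1 -big_split /=.
have -> : #|crossed H| = \sum_w (w \in crossed H : nat).
  by rewrite -sum1_card big_mkcond; apply: eq_bigr => w _; case: (w \in _).
rewrite -big_split /=; apply: eq_bigr => -[[p j] [q l]] _.
rewrite inE /crosses /swap_cols /=.
have [<-|pq] /= := eqVneq p q.
  rewrite addn0; have [<-|jl] := eqVneq j l; first by rewrite !adj_irr eqxx.
  have Hjl a b : a != b -> H (p, a) (p, b).
    by move=> ab; apply: sGH; rewrite /= /rook_adj /= eqxx (negPf ab).
  have lj : l != j by rewrite eq_sym.
  by rewrite !Hjl // xpair_eqE (negPf jl) andbF.
have [<-|jl] /= := eqVneq j l.
  rewrite addn0 sGH /= ?xpair_eqE ?(negPf pq) //.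
  by rewrite /rook_adj /= eqxx (negPf pq).
suff : H (p, j) (q, l) || H (p, l) (q, j).
  by case: (H _ _); case: (H _ _).
rewrite (adj_sym H (p, l)).
apply: (chordal_square (b := (q, j)) (d := (p, l)) chH).
- by rewrite /= !inE !xpair_eqE !eqxx (eq_sym q p) (negPf pq) (negPf jl).
- by apply: sGH; rewrite /= /rook_adj /= eqxx (negPf pq).
- by apply: sGH; rewrite /= /rook_adj /= eqxx (negPf jl).
- by apply: sGH; rewrite /= /rook_adj /= eqxx eq_sym (negPf pq).
- by apply: sGH; rewrite /= /rook_adj /= eqxx eq_sym (negPf jl).
Qed.

Definition offdiag (T : finType) (A : {set T}) : {set T * T} :=
  [set u : T * T | [&& u.1 \in A, u.2 \in A & u.1 != u.2]].

Lemma card_offdiag (T : finType) (A : {set T}) :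
  #|offdiag A| = #|A| * #|A|.-1.
Proof.
rewrite -sum1dep_card.
rewrite -(pair_big_dep (mem A) (fun x y => (y \in A) && (x != y)) (fun _ _ => 1)) /=.
rewrite -sum_nat_const; apply: eq_bigr => x xA.
rewrite sum1dep_card (cardsD1 x A) xA /=.
by apply: eq_card => y; rewrite !inE andbC eq_sym.
Qed.

Definition cross_pairs (A : {set 'I_4}) (K : {set 'I_n}) : {set cell * cell} :=
  [set w : cell * cell |
    ((w.1.1, w.2.1) \in offdiag A) && ((w.1.2, w.2.2) \in offdiag K)].

Lemma card_cross_pairs (A : {set 'I_4}) (K : {set 'I_n}) :
  #|cross_pairs A K| = #|A| * #|A|.-1 * (#|K| * #|K|.-1).
Proof.
pose f (w : ('I_4 * 'I_4) * ('I_n * 'I_n)) : cell * cell :=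
  ((w.1.1, w.2.1), (w.1.2, w.2.2)).
have injf : injective f by move=> [[p q] [j l]] [[p' q'] [j' l']] [-> -> -> ->].
rewrite -!card_offdiag -cardsX -(card_imset _ injf).
apply: eq_card => -[[p j] [q l]]; rewrite inE /=.
apply/idP/imsetP => [pqjl | [[[p' q'] [j' l']]]].
  by exists ((p, q), (j, l)); rewrite // in_setX.
by rewrite in_setX => w [-> -> -> ->].
Qed.

Lemma joined_crossed (H : sgraph cell) (A : {set 'I_4}) (K : {set 'I_n}) :
  clique H (setX A K) -> cross_pairs A K \subset crossed H.
Proof.
move=> cH; apply/subsetP=> -[[p j] [q l]]; rewrite !inE /crosses /=.
move=> /andP[/and3P[pA qA pq] /and3P[jK lK jl]]; rewrite pq jl /=.
by rewrite !cH ?in_setX ?pA ?qA ?jK ?lK // xpair_eqE (negPf pq).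
Qed.

(** The complementary row pairs give disjoint families of at least [2 * ((n - 2) * (n - 3))] ordered
    pairs each. *)
Lemma card_crossed_ge (H : sgraph cell) (A : {set 'I_4}) : 2 <= n ->
  #|A| = 2 -> joined H A -> joined H (~: A) ->
  4 * ((n - 2) * (n - 3)) <= #|crossed H|.
Proof.
move=> n2 A2 [K nK cK] [K' nK' cK'].
have A2' : #|~: A| = 2 by rewrite cardsCs setCK card_ord A2.
have dis : cross_pairs A K :&: cross_pairs (~: A) K' = set0.
  apply/setP=> -[[p j] [q l]]; rewrite !inE /=; case: (p \in A) => //=.
  by rewrite andbF.
have sub : cross_pairs A K :|: cross_pairs (~: A) K' \subset crossed H.
  by rewrite subUset !joined_crossed.
apply: leq_trans (subset_leq_card sub).
rewrite cardsU dis cards0 subn0 !card_cross_pairs A2 A2'.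
have le k : n <= k + 2 -> (n - 2) * (n - 3) <= k * k.-1.
  by move=> nk; apply: leq_mul; lia.
rewrite -mulnDr -[4]/(2 * 2) -mulnA leq_mul2l /= mul2n -addnn.
exact: leq_add (le _ nK) (le _ nK').
Qed.

End Rook.

Import Order.TTheory GRing.Theory Num.Theory.

(** * A triangulation with few edges *)

(** The two cycle neighbours of a vertex of least rank are adjacent, which is a chord when the cycle
    has length at least four. Ties in rank are allowed. *)
Lemma peo_chordal (T : finType) (G : sgraph T) (rank : T -> nat) :
  (forall x y z, rank x <= rank y -> rank x <= rank z ->
    G x y -> G x z -> y != z -> G y z) -> chordal G.
Proof.
move=> peo c cc szc.
have [x0 x0c] : exists x, x \in c.
  by case: c szc {cc} => // x c; exists x; apply: mem_head.
case: (@arg_minnP _ x0 (mem c) rank x0c) => x xc minx.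
have [k c' Ec] := rot_to xc.
have Uc : uniq c by case/andP: cc.
have mem_c z : z \in x :: c' -> z \in c by rewrite -Ec mem_rot.
have : ucycle G (x :: c').
  by move: cc; rewrite /ucycle -(rot_cycle k) -(rot_uniq k) Ec.
have {szc} : 4 <= size (x :: c') by rewrite -Ec size_rot.
case/lastP: c' mem_c Ec => [|[|y [|t c']] z] //= mem_c Ec _.
rewrite /ucycle /= !rcons_path !last_rcons /= !inE !mem_rcons !inE !negb_or.
move=> /andP[/and4P[Gxy _ _ Gzx] /and4P[/and4P[xy xt xz _] /and3P[yt yz _] /andP[tz _] _]].
have yc : y \in c by apply: mem_c; rewrite !inE eqxx orbT.
have zc : z \in c by apply: mem_c; rewrite !(inE, mem_rcons) eqxx !orbT.
exists y, z; split=> //.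
- by apply: (peo x); rewrite ?minx // adj_sym.
- by rewrite -(next_rot k Uc) Ec /= (eq_sym y x) (negPf xy) eqxx eq_sym.
- have Er : x :: y :: t :: rcons c' z = [:: x, y, t & c'] ++ [:: z].
    by rewrite cats1.
  have Us : uniq ([:: x, y, t & c'] ++ [:: z]) by rewrite -Er -Ec rot_uniq.
  rewrite -(next_rot k Uc) Ec Er -(next_rot (size [:: x, y, t & c']) Us).
  by rewrite rot_size_cat /= eqxx eq_sym.
Qed.

Section Forked.

Variable n : nat.

(* Place rows and columns on the nodes of a tree and let a cell be the path from
   its row to its column; [forked] is the intersection graph of these paths.
   The tree is a path carrying columns 3, ..., n - 3, with two legs at each end:
   {column 1} - {row 0, column 0} and {row 1, column 2} on the left,
   {row 2, column n - 1} and {row 3, column n - 2} on the right.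
   [forked_rel p q j l] is the adjacency of (p, j) and (q, l) for p < q. *)
Definition forked_rel (p q j l : nat) : bool :=
  match p, q with
  | 0, 1 => [|| j == l, (1 < j) && (l != 2), j == 2 | (j == 1) && (l == 0)]
  | 0, 2 => l <= j
  | 0, 3 => (j == n - 2) || (l <= j) && (l != n - 2)
  | 1, 2 => if j == 2 then l == 2 else (l <= j) || (l <= 2)
  | 1, 3 => if j == 2 then l == 2
            else (j == n - 2) || ((l <= j) || (l <= 2)) && (l != n - 2)
  | 2, 3 => (j == l) || (j != n - 1) && (l != n - 2)
  | _, _ => false
  end.

Definition forked_nat (p q j l : nat) : bool :=
  if p == q then j != l else if p < q then forked_rel p q j l
  else forked_rel q p l j.

Definition forked_adj : rel ('I_4 * 'I_n) :=
  fun u v => forked_nat u.1 v.1 u.2 v.2.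

Lemma forked_adj_sym : symmetric forked_adj.
Proof.
move=> [p j] [q l]; rewrite /forked_adj /forked_nat /= (eq_sym (q : nat)) (eq_sym (l : nat)).
by case: ltngtP.
Qed.

Lemma forked_adj_irr : irreflexive forked_adj.
Proof. by move=> u; rewrite /forked_adj /forked_nat !eqxx. Qed.

Definition forked : sgraph ('I_4 * 'I_n)%type :=
  SGraph forked_adj_sym forked_adj_irr.

(* A perfect elimination ordering: from the tips of the legs to the right end. *)
Definition forked_rank (p j : nat) : nat :=
  match p with
  | 0 => j
  | 1 => if j == 2 then 0 else maxn j 2
  | 2 => if j == n - 1 then 0 else n
  | _ => if j == n - 2 then 0 else n
  end.

Lemma forked_nat_peo (p q r j l k : nat) : 6 <= n -> p < 4 -> q < 4 -> r < 4 ->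
  j < n -> l < n -> k < n ->
  forked_rank p j <= forked_rank q l -> forked_rank p j <= forked_rank r k ->
  forked_nat p q j l -> forked_nat p r j k -> (q != r) || (l != k) ->
  forked_nat q r l k.
Proof.
(* Once the three rows are fixed, ranks and adjacencies are linear conditions on the columns. *)
case: p => [|[|[|[|//]]]]; case: q => [|[|[|[|//]]]]; case: r => [|[|[|[|//]]]];
  move=> n6 _ _ _; rewrite /forked_nat /forked_rank /=; do ?[case: ifP => ?]; lia.
Qed.

Lemma chordal_forked : 6 <= n -> chordal forked.
Proof.
move=> n6; apply: (@peo_chordal _ _ (fun u : 'I_4 * 'I_n => forked_rank u.1 u.2)).
move=> [p j] [q l] [r k] /= qr rk Gpq Gpr; rewrite xpair_eqE negb_and => qlrk.
by apply: (@forked_nat_peo p q r j l k).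
Qed.

Lemma rook_sub_forked : subrel (rook 4 n) forked.
Proof.
move=> [[p p4] [j jn]] [[q q4] [l ln]]; rewrite /= /rook_adj /forked_adj /=.
rewrite -!val_eqE /forked_nat /=.
have [_|npq] := eqVneq p q; first by rewrite addTb.
rewrite addFb => /eqP <-; case: p p4 npq => [|[|[|[|//]]]] _;
  case: q q4 => [|[|[|[|//]]]] _ //= _; do ?[case: ifP => ?]; lia.
Qed.

Lemma triangulation_forked : 6 <= n -> triangulation (rook 4 n) forked.
Proof. by move=> n6; split; [apply: chordal_forked | apply: rook_sub_forked]. Qed.

Lemma card_crossed_forked : 6 <= n ->
  #|crossed forked| < 4 * ((n - 2) * (n - 3)).
Proof.
move=> n6; pose R (p q : nat) := [set i : 'I_4 | (i == p :> nat) || (i == q :> nat)].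
pose K3 := [set j : 'I_n | 3 <= j]; pose Kn := [set j : 'I_n | j < n - 2].
pose K2 := [set j : 'I_n | j < 2].
have cR p q : p < q -> q < 4 -> #|R p q| = 2.
  move=> pq q4; pose p' : 'I_4 := Ordinal (ltn_trans pq q4).
  have -> : R p q = [set p'; Ordinal q4] by apply/setP=> i; rewrite !inE -!val_eqE.
  by rewrite cards2 -val_eqE /= neq_ltn pq.
(* Apart from the two large families, only the rectangles on columns 0 and 1 with rows 1, 2 or rows
   1, 3 can have both diagonals. *)
have sub : crossed forked \subset cross_pairs (R 0 1) K3 :|: cross_pairs (R 2 3) Kn
    :|: cross_pairs (R 1 2) K2 :|: cross_pairs (R 1 3) K2.
  apply/subsetP=> -[[[p p4] [j jn]] [[q q4] [l ln]]].
  rewrite !inE /crosses /= /forked_adj /forked_nat -!val_eqE /=.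
  case: p p4 => [|[|[|[|//]]]] _; case: q q4 => [|[|[|[|//]]]] _ //=;
    do ?[case: ifP => ?]; lia.
apply: leq_ltn_trans (subset_leq_card sub) _.
have leU (A B : {set ('I_4 * 'I_n) * ('I_4 * 'I_n)}) : #|A :|: B| <= #|A| + #|B|.
  by rewrite cardsU leq_subr.
have cK3 : #|K3| = n - 3 by rewrite card_ord_ge //; lia.
have cKn : #|Kn| = n - 2 by rewrite card_ord_lt //; lia.
have cK2 : #|K2| = 2 by rewrite card_ord_lt //; lia.
apply: (@leq_ltn_trans (#|cross_pairs (R 0 1) K3| + #|cross_pairs (R 2 3) Kn|
    + #|cross_pairs (R 1 2) K2| + #|cross_pairs (R 1 3) K2|)).
  by do 2![apply: leq_trans (leU _ _) _; rewrite leq_add2r].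
rewrite !card_cross_pairs !cR // cK3 cKn cK2.
(* The sum equals [4 * (n - 3) ^ 2 + 8], and [8 < 4 * (n - 3)] holds from [n = 6] on. *)
have [m ->] : exists m, n = m + 6 by exists (n - 6); lia.
rewrite (_ : m + 6 - 3 = m + 3) 1?(_ : m + 6 - 2 = m + 4); [|lia|lia].
rewrite (_ : (m + 3).-1 = m + 2) 1?(_ : (m + 4).-1 = m + 3); [|lia|lia].
by rewrite /=; clear; nia.
Qed.

End Forked.

(** * The strict gap in treewidth *)

Lemma tau_gt0 (T : finType) (G : sgraph T) :
  (forall H, min_triangulation G H -> tw H <> tw G) -> (0 < tau G)%R.
Proof.
move=> neq; rewrite /tau; case: ex_minnP => k /asboolP[H [mH twH]] _.
have := tw_subrel mH.1.2; have := neq H mH; rewrite twH => /eqP ne le.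
by rewrite subr_gt0 ltz_nat ltn_neqAle eq_sym ne.
Qed.

Theorem mainTheorem1 (n : nat) (hn : 6 <= n) :
  (~ exists Hs : sgraph ('I_4 * 'I_n)%type,
       min_triangulation (rook 4 n) Hs /\ tw Hs = tw (rook 4 n))
  /\ (0 < tau (rook 4 n))%R.
Proof.
have no_min H : min_triangulation (rook 4 n) H -> tw H <> tw (rook 4 n).
  move=> [[chH sGH] minH] twH.
  have n0 : 0 < n by apply: leq_trans hn.
  (* A clique has at most [tw H + 1] vertices, and [tw H = tw (rook 4 n) <= 2 * n + 1]. *)
  have leQ (Q : {set 'I_4 * 'I_n}) : clique H Q -> #|Q| <= (n.+1).*2.
    move=> cQ; apply: leq_trans (clique_tw_le (tw_le_tw H) cQ) _.
    by rewrite twH doubleS ltnS rook_tw_le.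
  have [|A A2 [jA jAC]] := two_joined_pairs _ chH sGH leQ.
    by apply: leq_trans hn.
  have geH : 4 * ((n - 2) * (n - 3)) <= #|crossed H|.
    by apply: card_crossed_ge jA jAC => //; apply: leq_trans hn.
  have tC := triangulation_forked hn.
  have := minH _ tC; rewrite leqNgt => /negP[].
  (* Multiplied by four, both edge counts split into the same constant plus [crossed], so only the
     latter are compared. *)
  rewrite -(ltn_pmul2r (isT : 0 < 4)).
  rewrite (card_edges_rook tC.1 tC.2) (card_edges_rook chH sGH) ltn_add2l.
  exact: leq_trans (card_crossed_forked hn) geH.
split; last exact: tau_gt0.
by case=> H [mH twH]; apply: no_min twH.
Qed.
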